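(* Let $U\neq\emptyset$ be a set, $m\geq1$, and $F,G_1,\ldots,G_m\colon U\to\mathbb{R}\cup\{+\infty\}$. For $\alpha=(\alpha_1,\ldots,\alpha_m)\in[0,+\infty)^m$ let $H_\alpha\colon U\to\mathbb{R}\cup\{+\infty\}$, $H_\alpha(u):=F(u)+\sum_{j=1}^m\alpha_jG_j(u)$, and assume that there exist $\bar u\in U$ and $\bar\alpha\in(0,+\infty)^m$ with $H_{\bar\alpha}(\bar u)<+\infty$. Then for Lebesgue-almost all $\alpha\in[0,+\infty)^m$ the following holds: if $\inf_{u\in U}H_\alpha(u)>-\infty$, then there exist $G_\alpha^1,\ldots,G_\alpha^m\in[-\infty,+\infty]$ such that $G_j(u_i)\to G_\alpha^j$ as $i\to\infty$ for every $j=1,\ldots,m$ and for every minimizing sequence $(u_i)_{i\in\mathbb{N}}$ of $H_\alpha$.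
   Context: A minimizing sequence of $H_\alpha$ is a sequence $(u_i)_{i\in\mathbb{N}}$ in $U$ with $\lim_{i\to\infty}H_\alpha(u_i)=\inf_{u\in U}H_\alpha(u)$. No structure on $U$ and no measurability of $F,G_1,\ldots,G_m$ is assumed. Convention: $0\cdot(+\infty)=0$. *)

(* Defs.v *)
From HB Require Import structures.
From mathcomp Require Import all_boot all_order all_algebra.
From mathcomp Require Import all_classical all_reals all_analysis.

Set Implicit Arguments.
Unset Strict Implicit.
Unset Printing Implicit Defensive.

Import Order.TTheory GRing.Theory Num.Theory.
Import numFieldNormedType.Exports.

Local Open Scope classical_set_scope.
Local Open Scope ring_scope.

Section cons_pair.
Context (d : measure_display) (T : measurableType d) (n : nat).

Definition cons_pair (p : T * n.-tuple T) : n.+1.-tuple T :=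
  [tuple of p.1 :: p.2].

Lemma measurable_cons_pair : measurable_fun [set: T * n.-tuple T] cons_pair.
Proof. exact: measurable_cons. Qed.

End cons_pair.

Section cons_measure.
Context (d : measure_display) (T : measurableType d) (R : realType) (n : nat).
Variable mu : {sigma_finite_measure set T -> \bar R}.
Variable nu : {sigma_finite_measure set (n.-tuple T) -> \bar R}.

Definition cons_measure : set (n.+1.-tuple T) -> \bar R :=
  pushforward (mu \x nu)%E (@cons_pair d T n).

(* In the context so that the [Measure] instance of [pushforward] applies. *)
Let mcons := @measurable_cons_pair d T n.

Let cons_measure0 : cons_measure set0 = 0%E.
Proof. exact: measure0. Qed.

Let cons_measure_ge0 A : (0 <= cons_measure A)%E.
Proof. exact: measure_ge0. Qed.

Let cons_measure_sigma_additive : semi_sigma_additive cons_measure.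
Proof. exact: measure_semi_sigma_additive. Qed.

HB.instance Definition _ := isMeasure.Build _ _ _ cons_measure
  cons_measure0 cons_measure_ge0 cons_measure_sigma_additive.

Let cons_measure_sigma_finite : sigma_finite setT cons_measure.
Proof.
have /sigma_finiteP[F [TF ndF Foo]] := sigma_finiteT mu.
have /sigma_finiteP[G [TG ndG Goo]] := sigma_finiteT nu.
pose uncons (t : n.+1.-tuple T) : T * n.-tuple T :=
  (tnth t ord0, [tuple of behead t]).
have consK : cancel (@cons_pair d T n) uncons.
  by case=> x t; rewrite /uncons; congr pair => //; exact: val_inj.
have munc : measurable_fun setT uncons.
  apply/measurable_fun_pair; first exact: measurable_tnth.
  exact: measurable_behead.
exists (fun k => uncons @^-1` (F k `*` G k)).
  apply/esym/seteqP; split=> // t _.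
  have [i _ Fi] : (\bigcup_k F k) (uncons t).1 by rewrite -TF.
  have [j _ Gj] : (\bigcup_k G k) (uncons t).2 by rewrite -TG.
  exists (maxn i j) => //; split.
    by move: Fi; exact/subsetPset/ndF/leq_maxl.
  by move: Gj; exact/subsetPset/ndG/leq_maxr.
move=> k; have [mF Fk] := Foo k; have [mG Gk] := Goo k; split.
  by rewrite -[X in measurable X]setTI; apply: munc => //; exact: measurableX.
rewrite /cons_measure /pushforward -comp_preimage.
rewrite (_ : _ @^-1` _ = F k `*` G k); last first.
  by apply/seteqP; split=> p; rewrite /preimage /mkset [(_ \o _) p]consK.
by rewrite product_measure1E// lte_mul_pinfty// ge0_fin_numE.
Qed.

HB.instance Definition _ := Measure_isSigmaFinite.Build _ _ _ cons_measure
  cons_measure_sigma_finite.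

End cons_measure.

(* The m-dimensional Lebesgue measure, as the m-fold product of the
   one-dimensional one; [lebesgue_tuple_box] gives its values on boxes. *)
Fixpoint lebesgue_tuple (R : realType) (m : nat) :
    {sigma_finite_measure set (m.-tuple (measurableTypeR R)) -> \bar R} :=
  match m with
  | 0%N => \d_ [tuple]
  | n.+1 => cons_measure (@lebesgue_measure R) (lebesgue_tuple R n)
  end.

Lemma lebesgue_tuple_box (R : realType) (m : nat)
    (A : 'I_m -> set (measurableTypeR R)) :
  (forall j, measurable (A j)) ->
  lebesgue_tuple R m [set x | forall j, A j (tnth x j)] =
  (\prod_(j < m) lebesgue_measure (A j))%E.
Proof.
elim: m A => [|n IH] A mA.
  by rewrite big_ord0 /= diracE mem_set// => -[].
rewrite big_ord_recl -IH//= /cons_measure /pushforward.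
rewrite (_ : _ @^-1` _ =
  A ord0 `*` [set x | forall j, A (lift ord0 j) (tnth x j)]); last first.
  apply/seteqP; split=> -[x t] /=.
    move=> H; split; first exact: (H ord0).
    by move=> j; have := H (lift ord0 j); rewrite tnthS.
  by move=> [Ax At] j; case: (unliftP ord0 j) => [i|] ->//; rewrite tnthS.
rewrite product_measure1E//.
rewrite (_ : mkset _ = \bigcap_j ((@tnth _ _)^~ j @^-1` A (lift ord0 j))).
  apply: fin_bigcap_measurable => // j _.
  by rewrite -[X in measurable X]setTI; exact: measurable_tnth.
by apply/seteqP; split=> t /= H j //=; exact: H.
Qed.

Section penalized.
Context (R : realType) (U : Type) (m : nat).
Variables (F : U -> \bar R) (G : 'I_m -> U -> \bar R).

(* H_alpha; the product of \bar R satisfies 0 * +oo = 0. *)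
Definition penalized (alpha : m.-tuple R) (u : U) : \bar R :=
  (F u + \sum_(j < m) (tnth alpha j)%:E * G j u)%E.

End penalized.

Definition minimizing_sequence (R : realType) (U : Type) (H : U -> \bar R)
    (u : nat -> U) : Prop :=
  H (u i) @[i --> \oo] --> ereal_inf (range H).

(* Main.v *)
(* On the open orthant, inf_u H_alpha(u) is an infimum J(alpha) of affine
   functions of alpha, one for each u where F and all G_j are finite; hence J is
   concave. Comparing H_alpha with H at alpha shifted by t along the j-th axis
   bounds G_j(u_i), for a minimizing sequence u_i, between the right and left
   difference quotients of J, so G_j(u_i) converges as soon as the left
   derivative does not exceed the right one. On a line parallel to an axis the
   points where it exceeds the right one form a countable set, so by Fubini they
   are negligible; measurability comes from replacing the affine functions by
   their countably many rational majorants, which have the same infimum. *)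

Require Import Defs.
From HB Require Import structures.
From mathcomp Require Import all_boot all_order all_algebra.
From mathcomp Require Import all_classical all_reals all_analysis.

From mathcomp Require Import measurable_realfun ring lra.

Set Implicit Arguments.
Unset Strict Implicit.
Unset Printing Implicit Defensive.

Import Order.TTheory GRing.Theory Num.Theory.
Import numFieldNormedType.Exports.

Local Open Scope classical_set_scope.
Local Open Scope ring_scope.

(** * Null sets of the product Lebesgue measure *)

Lemma lebesgue_measure_subsingleton (R : realType)
    (A : set (measurableTypeR R)) :
  (forall x y, A x -> A y -> x = y) -> lebesgue_measure A = 0%E.
Proof.
move=> A1; have [[x Ax]|/set0P/negP/negPn/eqP ->] := pselect (A !=set0);
  last exact: measure0.
rewrite (_ : A = [set x]) ?lebesgue_measure_set1//.
by apply/seteqP; split=> [y Ay|y ->//]; exact: A1.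
Qed.

(** Fubini, by induction on [m]: splitting off the first coordinate, either [j] lies among the
    remaining ones and every section is null by induction, or [j] is the first one and the sections
    along it have at most one point. *)
Lemma lebesgue_tuple_line_subsingleton (R : realType) (m : nat) (j : 'I_m)
    (N : set (m.-tuple (measurableTypeR R))) :
  measurable N ->
  (forall a b, N a -> N b ->
     (forall i, i != j -> tnth a i = tnth b i) -> a = b) ->
  lebesgue_tuple R m N = 0%E.
Proof.
elim: m j N => [|n IH] j N mN N1; first by case: j {N1}.
have mN' : measurable (@cons_pair _ (measurableTypeR R) n @^-1` N).
  by rewrite -[X in measurable X]setTI; exact: measurable_cons_pair.
rewrite /= /cons_measure /pushforward; move: N1.
have [i|] := unliftP ord0 j => -> N1.
  rewrite /product_measure1 integral0_eq// => x _ /=.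
  apply: (IH i); first exact: measurable_xsection.
  move=> a b /xsectionP Na /xsectionP Nb ab.
  suff /(congr1 val)[] : cons_pair (x, a) = cons_pair (x, b).
    by move=> ?; exact: val_inj.
  apply: N1 => // k; have [l|] := unliftP ord0 k => -> //.
  by rewrite !tnthS (inj_eq lift_inj); exact: ab.
(* Here the sections along the first coordinate are needed, so the product measure is rewritten as
   the iterated integral in the other order. *)
have -> := product_measure_unique (m' := (lebesgue_measure \x^ lebesgue_tuple R n)%E).
- rewrite /= /product_measure2 integral0_eq// => y _ /=.
  apply: lebesgue_measure_subsingleton => a b /ysectionP Na /ysectionP Nb.
  suff /(congr1 val)[] : cons_pair (a, y) = cons_pair (b, y) by [].
  apply: N1 => // k; have [l|] := unliftP ord0 k => -> //.
  by rewrite !tnthS.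
- by move=> A B mA mB; rewrite -product_measure2E.
- by [].
Qed.

(** * Infima of affine functions and their measurability *)

Definition affine_fun (R : realType) (m : nat) (c : R) (g : 'I_m -> R)
    (a : m.-tuple R) : R :=
  c + \sum_(j < m) tnth a j * g j.

Definition inf_affine (R : realType) (m : nat) (T : Type) (c : T -> R)
    (g : T -> 'I_m -> R) (a : m.-tuple R) : \bar R :=
  ereal_inf (range (fun q => (affine_fun (c q) (g q) a)%:E)).

Lemma inf_affine_le (R : realType) (m : nat) (T : Type) (c : T -> R)
    (g : T -> 'I_m -> R) (a : m.-tuple R) (q : T) :
  (inf_affine c g a <= (affine_fun (c q) (g q) a)%:E)%E.
Proof. by apply: ge_ereal_inf; eexists; first by exists q. Qed.

Definition shift_coord (R : realType) (m : nat) (j : 'I_m) (t : R)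
    (a : m.-tuple R) : m.-tuple R :=
  [tuple tnth a i + t *+ (i == j) | i < m].

Lemma affine_fun_shift (R : realType) (m : nat) (c : R) (g : 'I_m -> R)
    (j : 'I_m) (t : R) (a : m.-tuple R) :
  affine_fun c g (shift_coord j t a) = affine_fun c g a + t * g j.
Proof.
rewrite /affine_fun -addrA; congr +%R.
under eq_bigr do rewrite tnth_mktuple mulrDl.
rewrite big_split/=; congr +%R.
rewrite (bigD1 j)//= eqxx mulr1n big1 ?addr0// => i /negPf ->.
by rewrite mulr0n mul0r.
Qed.

Section measurability.
Context (R : realType) (m : nat).
Notation tupleR := (m.-tuple (measurableTypeR R)).

Lemma measurable_affine_fun (c : R) (g : 'I_m -> R) :
  measurable_fun [set: tupleR] (affine_fun c g : tupleR -> R).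
Proof.
apply: measurable_funD; first exact: measurable_cst.
apply: measurable_sum => j; apply: measurable_funM => //.
exact: measurable_tnth.
Qed.

(** The infimum is below [x] exactly when some member is, so its strict sublevel sets are countable
    unions of those of the members. *)
Lemma measurable_inf_affine (T : countType) (c : T -> R)
    (g : T -> 'I_m -> R) :
  measurable_fun [set: tupleR] (inf_affine c g : tupleR -> \bar R).
Proof.
move=> mD; apply: (measurability _ (ErealGenInftyO.measurableE R)) => //.
move=> _ [_ [x ->] <-]; rewrite setTI.
rewrite (_ : _ @^-1` _ =
  \bigcup_q [set a : tupleR | affine_fun (c q) (g q) a < x]); last first.
  apply/seteqP; split=> a /=; rewrite in_itv/=.
    by move=> /ereal_inf_lt[_ [q _ <-]]; rewrite lte_fin => ?; exists q.
  by move=> [q _ /= qx]; apply/ereal_inf_ltP; exists (affine_fun (c q) (g q) a)%:E.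
apply: countable_bigcupT_measurable => // q.
rewrite -[X in measurable X]setTI.
rewrite (_ : [set _ | _] = (affine_fun (c q) (g q) : tupleR -> R) @^-1` `]-oo, x[).
  exact: measurable_affine_fun.
by apply/seteqP; split=> a /=; rewrite in_itv.
Qed.

Lemma measurable_shift_coord (j : 'I_m) (t : R) :
  measurable_fun [set: tupleR] (shift_coord j t : tupleR -> tupleR).
Proof.
apply/measurable_fun_tnthP => i.
under [X in measurable_fun _ X]eq_fun do rewrite /= tnth_mktuple.
by apply: measurable_funD => //; exact: measurable_tnth.
Qed.

End measurability.

(** * Kinks of a concave function along an axis *)

Section kinks.
Context (R : realType) (m : nat) (T : countType).
Variables (c : T -> R) (g : T -> 'I_m -> R).
Local Notation J := (inf_affine c g).

(** This is concavity, for either sign of [t]: a member within [t * r + e / l] of [J a] at the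
    shifted point is at least [J a] at [a], and extrapolating it by the factor [l] turns the error
    [e / l] into [e]. *)
Lemma inf_affine_shift_le (j : 'I_m) (t l r : R) (a : m.-tuple R) :
  J a \is a fin_num -> 1 <= l ->
  (J (shift_coord j t a) <= J a + (t * r)%:E)%E ->
  (J (shift_coord j (l * t) a) <= J a + (l * t * r)%:E)%E.
Proof.
move=> /fineK Ja l1; rewrite -Ja -!EFinD => Jt.
have l0 : 0 < l by lra.
apply/lee_addgt0Pr => e e0.
have /ereal_inf_lt[_ [q _ <-]] :
    (J (shift_coord j t a) < (fine (J a) + t * r + e / l)%:E)%E.
  by apply: le_lt_trans Jt _; rewrite lte_fin ltrDl divr_gt0.
rewrite affine_fun_shift lte_fin => qt.
have := inf_affine_le c g a q; rewrite -Ja lee_fin => qa.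
apply: le_trans (inf_affine_le c g _ q) _.
rewrite affine_fun_shift lee_fin.
have -> : e = l * (e / l) by field; rewrite gt_eqF.
nra.
Qed.

(* For r < s this contains the points where the right derivative of J in
   direction j is below r and the left one above s; by concavity each line
   parallel to the j-th axis meets it at most once. Countably many increments
   suffice and keep it measurable. *)
Definition kink (j : 'I_m) (r s : R) : set (m.-tuple (measurableTypeR R)) :=
  [set a | J a \is a fin_num] `&`
  \bigcap_(n : nat)
    ([set a | (J (shift_coord j n.+1%:R^-1 a) <= J a + (n.+1%:R^-1 * r)%:E)%E] `&`
     [set a | (J (shift_coord j (- n.+1%:R^-1) a) <=
               J a + (- n.+1%:R^-1 * s)%:E)%E]).

Lemma measurable_kink (j : 'I_m) (r s : R) : measurable (kink j r s).
Proof.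
have mJ := measurable_inf_affine c g.
have mJt t : measurable_fun [set: m.-tuple (measurableTypeR R)]
    (fun a => J (shift_coord j t a)).
  exact: (measurableT_comp mJ (measurable_shift_coord _ _)).
apply: measurableI.
  by rewrite -[X in measurable X]setTI; exact: emeasurable_fin_num.
apply: bigcapT_measurable => n; apply: measurableI;
  rewrite -[X in measurable X]setTI; apply: measurable_lee => //;
  by apply: emeasurable_funD => //; exact: measurable_cst.
Qed.

(** An increment [n.+1%:R^-1 <= t] is stretched to [t] by concavity, which gives
    [J b <= J a + t * r] and [J a <= J b - t * s]; adding these contradicts [r < s]. *)
Lemma kink_shift_lt (j : 'I_m) (r s t : R) (a b : m.-tuple R) :
  r < s -> 0 < t -> b = shift_coord j t a -> a = shift_coord j (- t) b ->
  kink j r s a -> kink j r s b -> False.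
Proof.
move=> rs t0 ba ab [/= Ja Ka] [/= Jb Kb].
have [n nt] : exists n, 1 <= t / n.+1%:R^-1.
  exists (Num.truncn t^-1); rewrite invrK.
  have := truncnS_gt t^-1.
  rewrite -(ltr_pM2l t0) mulfV ?gt_eqF//; exact: ltW.
have [+ _] := Ka n I => /(inf_affine_shift_le Ja nt).
have [_ +] := Kb n I => /(inf_affine_shift_le Jb nt).
have n0 : n.+1%:R^-1 != 0 :> R by rewrite invr_eq0 pnatr_eq0.
rewrite mulrN !divfK// -ab -ba.
rewrite -(fineK Ja) -(fineK Jb) -!EFinD !lee_fin; nra.
Qed.

Lemma kink_null (j : 'I_m) (r s : R) :
  r < s -> (lebesgue_tuple R m (kink j r s) = 0)%E.
Proof.
move=> rs; apply: (lebesgue_tuple_line_subsingleton (j := j)).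
  exact: measurable_kink.
move=> a b Ka Kb abj.
have E (x y : m.-tuple R) : (forall i, i != j -> tnth x i = tnth y i) ->
    y = shift_coord j (tnth y j - tnth x j) x.
  move=> xy; apply: eq_from_tnth => i; rewrite tnth_mktuple.
  by case: eqVneq => [->|/xy ->]; rewrite ?mulr1n ?mulr0n ?addr0// addrC subrK.
have Eab := E a b abj; have Eba := E b a (fun i h => esym (abj i h)).
case: (ltgtP (tnth a j) (tnth b j)) => [lt|gt|eq].
- case: (kink_shift_lt rs _ Eab _ Ka Kb); first by rewrite subr_gt0.
  by rewrite opprB.
- case: (kink_shift_lt rs _ Eba _ Kb Ka); first by rewrite subr_gt0.
  by rewrite opprB.
- apply: eq_from_tnth => i; case: (eqVneq i j) => [->//|]; exact: abj.
Qed.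

End kinks.

(** * Reduction to countably many affine functions *)

Section rational_majorants.
Context (R : realType) (m : nat) (V : Type).
Variables (c : V -> R) (g : V -> 'I_m -> R).

(** Domination is coefficientwise, hence pointwise only where all coordinates are nonnegative;
    rational coefficients make the index type countable. *)
Definition rat_majorant : pred (rat * {ffun 'I_m -> rat}) :=
  fun q => `[< exists v, c v < ratr q.1 /\ forall j, g v j < ratr (q.2 j) >].

Definition rat_const (q : {q | rat_majorant q}) : R := ratr (val q).1.

Definition rat_slope (q : {q | rat_majorant q}) (j : 'I_m) : R :=
  ratr ((val q).2 j).

Lemma inf_rat_majorant_le (v : V) (a : m.-tuple R) :
  (inf_affine rat_const rat_slope a <= (affine_fun (c v) (g v) a)%:E)%E.
Proof.
apply/lee_addgt0Pr => e e0.
pose S := \sum_(j < m) `|tnth a j|.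
have S0 : 0 <= S by apply: sumr_ge0.
(* Raising every coefficient by at most [d] raises the value at [a] by at most [d * (1 + S) = e],
   whatever the signs in [a]. *)
pose d := e / (1 + S).
have d0 : 0 < d by rewrite divr_gt0//; lra.
have approx (x : R) : {p : rat | x < ratr p < x + d}.
  apply/cid; have [p] := @rat_in_itvoo R x (x + d) ltac:(by rewrite ltrDl).
  by rewrite in_itv/=; exists p.
pose q0 := sval (approx (c v)).
pose q1 : {ffun 'I_m -> rat} := [ffun j => sval (approx (g v j))].
have qP : rat_majorant (q0, q1).
  apply/asboolP; exists v; split=> [|j] /=; last rewrite ffunE.
    by have /andP[] := svalP (approx (c v)).
  by have /andP[] := svalP (approx (g v j)).
have /le_trans := inf_affine_le rat_const rat_slope a
  (exist (fun q => rat_majorant q) (q0, q1) qP); apply.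
rewrite -EFinD lee_fin /affine_fun /rat_const /rat_slope /=.
have -> : e = d + \sum_(j < m) `|tnth a j| * d.
  by rewrite -mulr_suml -/S -{1}[d]mul1r -mulrDl mulrC divfK// gt_eqF//; lra.
rewrite addrACA -big_split/= lerD//.
  by have /andP[_ /ltW] := svalP (approx (c v)).
apply: ler_sum => j _; rewrite ffunE -lerBlDl -mulrBr.
have /andP[lo hi] := svalP (approx (g v j)).
apply: le_trans (ler_norm _) _; rewrite normrM ler_wpM2l// ger0_norm; lra.
Qed.

Lemma inf_affine_le_rat_majorant (a : m.-tuple R) :
  (forall j, 0 <= tnth a j) ->
  (inf_affine c g a <= inf_affine rat_const rat_slope a)%E.
Proof.
move=> a0; apply: le_ereal_inf_tmp => _ [q _ <-].
have /asboolP[v [cv gv]] := svalP q.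
have /le_trans := inf_affine_le c g a v; apply.
rewrite lee_fin /affine_fun lerD ?(ltW cv)// ler_sum// => j _.
by rewrite ler_wpM2l// ltW.
Qed.

End rational_majorants.

(** * Convergence of slopes away from the kinks *)

Lemma cvg_ereal_lt_gt (R : realType) (x : nat -> \bar R) (l : \bar R) :
  (forall r : R, (r%:E < l)%E -> \forall i \near \oo, (r%:E < x i)%E) ->
  (forall r : R, (l < r%:E)%E -> \forall i \near \oo, (x i < r%:E)%E) ->
  x i @[i --> \oo] --> l.
Proof.
case: l => [s lo hi|lo _|_ hi].
- move=> A [e /= e0 eA].
  have le : ((s - e)%:E < s%:E)%E by rewrite lte_fin ltrBlDr ltrDl.
  have he : (s%:E < (s + e)%:E)%E by rewrite lte_fin ltrDl.
  suff : \forall i \near \oo, A (x i) by [].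
  near=> i.
  have : ((s - e)%:E < x i)%E by near: i; exact: lo.
  have : (x i < (s + e)%:E)%E by near: i; exact: hi.
  rewrite /=; case: (x i) => [y|//|//]; rewrite !lte_fin => y1 y2.
  by apply: eA; rewrite /= ltr_norml; apply/andP; split; lra.
- by apply/cvgeyPgt => r; apply: lo; rewrite ltry.
- by apply/cvgeNyPlt => r; apply: hi; rewrite ltNyr.
Unshelve. all: by end_near. Qed.

(** For concave [J] finite at [a] this is the right derivative, since difference quotients grow as
    [t] decreases to 0. The form without division allows [J] to be [-oo] at shifted points; if it is
    so for all [t > 0], the supremum is that of the empty set, [-oo]. *)
Definition right_slope (R : realType) (m : nat) (J : m.-tuple R -> \bar R)
    (a : m.-tuple R) (j : 'I_m) : \bar R :=
  ereal_sup (EFin @` [set r | exists2 t, 0 < t &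
    (J a + (t * r)%:E < J (shift_coord j t a))%E]).

(* Comparing the i-th affine function at [a] and at [a] shifted by t bounds its
   j-th slope by a difference quotient of J, up to an error vanishing with i;
   t > 0 gives lower bounds and t < 0 upper bounds. *)
Lemma slope_cvg (R : realType) (m : nat) (T : countType) (c : T -> R)
    (g : T -> 'I_m -> R) (a : m.-tuple R) (j : 'I_m) (k : nat -> R)
    (h : nat -> 'I_m -> R) :
  let J := inf_affine c g in
  J a \is a fin_num ->
  (forall p q : rat, p < q -> ~ kink c g j (ratr p) (ratr q) a) ->
  (\forall i \near \oo, forall b, (J b <= (affine_fun (k i) (h i) b)%:E)%E) ->
  affine_fun (k i) (h i) a @[i --> \oo] --> fine (J a) ->
  (h i j)%:E @[i --> \oo] --> right_slope J a j.
Proof.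
move=> J Ja nokink Jk ka.
have kalt (e : R) : 0 < e ->
    \forall i \near \oo, affine_fun (k i) (h i) a < fine (J a) + e.
  by move=> e0; apply: (cvgr_lt _ ka); rewrite ltrDl.
apply: cvg_ereal_lt_gt => r.
- move=> /ereal_sup_gt[_ [r' [t t0 Jr'] <-]]; rewrite lte_fin => rr'.
  have e0 : 0 < t * (r' - r) by rewrite mulr_gt0// subr_gt0.
  near=> i.
  have lti : affine_fun (k i) (h i) a < fine (J a) + t * (r' - r).
    by near: i; exact: kalt.
  have Ji : forall b, (J b <= (affine_fun (k i) (h i) b)%:E)%E by near: i.
  have := lt_le_trans Jr' (Ji (shift_coord j t a)).
  rewrite -(fineK Ja) -EFinD !lte_fin affine_fun_shift => lo.
  by rewrite -(ltr_pM2l t0); nra.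
- move=> Lr.
  have [s Ls sr] : exists2 s, (right_slope J a j <= s%:E)%E & s < r.
    case: (right_slope J a j) Lr => [x|//|_]; first by rewrite lte_fin; exists x.
    by exists (r - 1); [rewrite leNye|rewrite ltrBlDr ltrDl].
  (* Rationals with [right_slope J a j < p < q < r] are chosen. As there is no kink for them, one of
     its two inequalities fails at some increment; it cannot be the right one, as [p] exceeds the
     right slope, so the left one fails and bounds the slopes by [q] up to the error. *)
  have [q] := rat_in_itvoo sr; rewrite in_itv/= => /andP[sq qr].
  have [p] := rat_in_itvoo sq; rewrite in_itv/= => /andP[sp].
  rewrite ltr_rat => /nokink/not_andP[//|/existsNP[n /not_implyP[_]]].
  set t : R := n.+1%:R^-1; have t0 : 0 < t by rewrite invr_gt0 ltr0n.
  move=> /not_andP[|/negP]; rewrite /= ?ltNge => Jn.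
    case: Jn; rewrite leNgt; apply/negP => Jn.
    have : ((ratr p)%:E <= right_slope J a j)%E.
      by apply: ereal_sup_ubound; exists (ratr p) => //; exists t.
    by apply/negP; rewrite -ltNge (le_lt_trans Ls).
  rewrite -ltNge in Jn.
  have e0 : 0 < t * (r - ratr q) by rewrite mulr_gt0// subr_gt0.
  near=> i.
  have lti : affine_fun (k i) (h i) a < fine (J a) + t * (r - ratr q).
    by near: i; exact: kalt.
  have Ji : forall b, (J b <= (affine_fun (k i) (h i) b)%:E)%E by near: i.
  have := lt_le_trans Jn (Ji (shift_coord j (- t) a)).
  rewrite -[inf_affine c g a](fineK Ja) -EFinD !lte_fin affine_fun_shift => lo.
  by rewrite -(ltr_pM2l t0); nra.
Unshelve. all: by end_near. Qed.

Lemma ae_forall_countable d (X : measurableType d) (R : realType)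
    (mu : {measure set X -> \bar R}) (T : countType) (P : T -> X -> Prop) :
  (forall t, {ae mu, forall x, P t x}) -> {ae mu, forall x t, P t x}.
Proof.
move=> aeP; have : {ae mu, forall x n, if unpickle n is Some t then P t x else True}.
  apply: ae_foralln => n; case: unpickle => [t|]; first exact: aeP.
  exact: aeW.
by apply: filterS => x + t => /(_ (pickle t)); rewrite pickleK.
Qed.

(** * The penalized function on the open orthant *)

Section finite_penalized.
Context (R : realType) (U : Type) (m : nat).
Variables (F : U -> \bar R) (G : 'I_m -> U -> \bar R).

Definition finite_point (u : U) : Prop :=
  F u \is a fin_num /\ forall j, G j u \is a fin_num.

Lemma penalized_finite_point (a : m.-tuple R) (u : U) : finite_point u ->
  penalized F G a u =
  (affine_fun (fine (F u)) (fun j => fine (G j u)) a)%:E.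
Proof.
move=> [Fu Gu]; rewrite /penalized /affine_fun EFinD -sumEFin fineK//.
by congr adde; apply: eq_bigr => j _; rewrite EFinM fineK.
Qed.

(** A positive weight keeps an infinite [G j u] infinite, whereas a zero weight would hide it by the
    convention on [0 * +oo]. *)
Lemma fin_num_finite_point (a : m.-tuple R) (u : U) :
  (forall j, 0 < tnth a j) -> penalized F G a u \is a fin_num ->
  finite_point u.
Proof.
move=> a0; rewrite /penalized fin_numD => /andP[Fu].
move=> /sum_fin_numP Gu; split=> // j.
have {Gu} := Gu j (mem_index_enum j) isT.
case: (G j u) => [//| |].
  by rewrite gt0_muley// lte_fin.
by rewrite gt0_muleNy// lte_fin.
Qed.

Hypothesis F_gtNy : forall u : U, (-oo < F u)%E.
Hypothesis G_gtNy : forall (j : 'I_m) (u : U), (-oo < G j u)%E.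

Lemma penalized_gtNy (a : m.-tuple R) (u : U) :
  (forall j, 0 < tnth a j) -> (-oo < penalized F G a u)%E.
Proof.
move=> a0; rewrite ltNye adde_eq_ninfty negb_or -ltNye F_gtNy/= esum_eqNy.
apply/negP => /existsP[j] /=; apply/negP; rewrite -ltNye.
case: (G j u) (G_gtNy j u) => [y _|_|//]; first by rewrite -EFinM ltNyr.
by rewrite gt0_muley// lte_fin.
Qed.

Lemma inf_penalized (a : m.-tuple R) : (forall j, 0 < tnth a j) ->
  ereal_inf (range (penalized F G a)) =
  inf_affine (fun u : {u | finite_point u} => fine (F (sval u)))
    (fun u j => fine (G j (sval u))) a.
Proof.
move=> a0; apply/eqP; rewrite eq_le; apply/andP; split.
  apply: le_ereal_inf_tmp => _ [[u Vu] _ <-] /=.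
  by rewrite -penalized_finite_point//; apply: ereal_inf_lbound; exists u.
apply: le_ereal_inf_tmp => _ [u _ <-].
have [->|/= Hu] := eqVneq (penalized F G a u) +oo%E; first exact: leey.
have Vu : finite_point u.
  apply: (fin_num_finite_point a0).
  by rewrite fin_numE Hu andbT gt_eqF// penalized_gtNy.
rewrite penalized_finite_point//.
apply: (inf_affine_le (fun u : {u | finite_point u} => fine (F (sval u))) _ a
  (exist _ u Vu)).
Qed.

End finite_penalized.

Theorem theorem4p1 (R : realType) (U : Type) (m : nat)
    (F : U -> \bar R) (G : 'I_m -> U -> \bar R)
    (U_nonempty : [set: U] !=set0) (m_ge1 : (1 <= m)%N)
    (F_gtNy : forall u : U, (-oo < F u)%E)
    (G_gtNy : forall (j : 'I_m) (u : U), (-oo < G j u)%E)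
    (H_proper : exists (ubar : U) (abar : m.-tuple R),
      (forall j : 'I_m, 0 < tnth abar j) /\
      (penalized F G abar ubar < +oo)%E) :
  {ae lebesgue_tuple R m, forall alpha : m.-tuple R,
    (forall j : 'I_m, 0 <= tnth alpha j) ->
    (-oo < ereal_inf (range (penalized F G alpha)))%E ->
    exists Galpha : 'I_m -> \bar R,
      forall (j : 'I_m) (u : nat -> U),
        minimizing_sequence (penalized F G alpha) u ->
        G j (u i) @[i --> \oo] --> Galpha j}.
Proof.
pose c (u : {u | finite_point F G u}) := fine (F (sval u)).
pose g (u : {u | finite_point F G u}) (j : 'I_m) := fine (G j (sval u)).
pose rc := @rat_const R m _ c g; pose rg := @rat_slope R m _ c g.
pose J := inf_affine rc rg.
(* This bound is kept for every [b], because the shifts of [a] used for difference quotients may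
   leave the orthant, where [J] need not be the infimum of [penalized]. *)
have JV b u : finite_point F G u ->
    (J b <= (affine_fun (fine (F u)) (fun j => fine (G j u)) b)%:E)%E.
  by move=> Vu; exact: (inf_rat_majorant_le c g (exist _ u Vu)).
have H_ltoo : exists u, finite_point F G u.
  have [u [a [a0 Hu]]] := H_proper; exists u.
  apply: (fin_num_finite_point a0).
  by rewrite fin_numElt Hu (penalized_gtNy F_gtNy G_gtNy).
(* Off these hyperplanes, a point of the closed orthant has only positive coordinates. *)
have null_coord j : {ae lebesgue_tuple R m, forall a : m.-tuple R, tnth a j <> 0}.
  exists [set a | tnth a j = 0]; split.
  - rewrite -[X in measurable X]setTI.
    exact: (@measurable_tnth _ (measurableTypeR R) m j _ _ (measurable_set1 0)).
  - apply: (lebesgue_tuple_line_subsingleton (j := j)).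
      rewrite -[X in measurable X]setTI.
      exact: (@measurable_tnth _ (measurableTypeR R) m j _ _ (measurable_set1 0)).
    move=> a b /= a0 b0 ab; apply: eq_from_tnth => i.
    by case: (eqVneq i j) => [->|/ab//]; rewrite a0 b0.
  - by move=> a /= /contrapT.
have null_kink (jpq : 'I_m * rat * rat) :
    {ae lebesgue_tuple R m, forall a : m.-tuple R, jpq.1.2 < jpq.2 ->
      ~ kink rc rg jpq.1.1 (ratr jpq.1.2) (ratr jpq.2) a}.
  case: jpq => [[j p] q] /=; have [pq|pq] := boolP (p < q); last first.
    by apply: aeW.
  exists (kink rc rg j (ratr p) (ratr q)); split; first exact: measurable_kink.
    by apply: kink_null; rewrite ltr_rat.
  by move=> a /= /not_implyP[_ /contrapT].
apply: filterS2 (ae_forall_countable null_coord) (ae_forall_countable null_kink).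
move=> a a_neq0 a_nokink a_ge0 a_inf.
have a0 j : 0 < tnth a j by rewrite lt_neqAle eq_sym a_ge0 andbT; exact/eqP.
have Ja : ereal_inf (range (penalized F G a)) = J a.
  apply/eqP; rewrite inf_penalized// eq_le inf_affine_le_rat_majorant//=.
  by apply: le_ereal_inf_tmp => _ [[u Vu] _ <-]; exact: JV.
have Jfin : J a \is a fin_num.
  rewrite fin_numElt -Ja a_inf Ja/=; have [u Vu] := H_ltoo.
  by apply: le_lt_trans (JV a u Vu) _; rewrite ltry.
(* The limit depends on [J] and [a] alone, hence is common to all minimizing sequences. *)
exists (right_slope J a) => j u; rewrite /minimizing_sequence Ja.
rewrite -(fineK Jfin) => /fine_cvgP[Hfin Hu].
(* Hence the default value 0 of [fine] at infinite values enters at finitely many indices only. *)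
have Vu : \forall i \near \oo, finite_point F G (u i).
  by apply: filterS Hfin => i; exact: fin_num_finite_point.
apply: cvg_trans (@slope_cvg _ _ _ _ _ a j (fun i => fine (F (u i)))
  (fun i j => fine (G j (u i))) Jfin _ _ _).
- apply: near_eq_cvg; apply: filterS Vu => i [_ Gu]; exact: fineK.
- move=> p q; exact: (a_nokink (j, p, q)).
- by apply: filterS Vu => i Vi b; exact: JV.
- apply: cvg_trans Hu; apply: near_eq_cvg; apply: filterS Vu => i Vi.
  by rewrite /= penalized_finite_point.
Qed.
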